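(* Let $X$ be an infinite, non-discrete Fréchet–Urysohn space. If the hyperspace $\mathcal{S}_c(X)$ of nontrivial convergent sequences of $X$, with the Vietoris topology, is path-wise connected, then $X$ is path-wise connected.
   Context: For a topological space $X$, $\mathcal{CL}(X)$ denotes the set of all nonempty closed subsets of $X$. For a nonempty family $\mathcal{U}$ of subsets of $X$, $\langle \mathcal{U}\rangle = \{F \in \mathcal{CL}(X) : F \subseteq \bigcup \mathcal{U} \text{ and } F \cap U \neq \emptyset \text{ for all } U \in \mathcal{U}\}$. The Vietoris topology on $\mathcal{CL}(X)$ has as a base the sets $\langle \mathcal{U}\rangle$, where $\mathcal{U}$ runs over all nonempty finite families of nonempty open subsets of $X$; every subset of $\mathcal{CL}(X)$ carries the subspace topology. A nontrivial convergent sequence of $X$ is a subset $S \subseteq X$ such that $|S| = \omega$ (countably infinite), $S$ has a unique non-isolated point $x_S$, and $S \setminus U$ is finite for each neighborhood $U$ of $x_S$. Then $\mathcal{S}_c(X) = \{S \in \mathcal{CL}(X) : S \text{ is a nontrivial convergent sequence}\}$. A space $X$ is Fréchet–Urysohn if whenever $A\subseteq X$ and $x \in \overline{A}$, there is a sequence of points of $A$ converging to $x$. A space is path-wise connected if any two of its points are joined by a continuous map from $[0,1]$ into the space.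
   Formalization: The space X is additionally assumed to be Hausdorff; without a separation axiom the claim fails, e.g. for the disjoint union of two infinite indiscrete spaces, where the hyperspace of nontrivial convergent sequences is empty but X is not connected. *)

(* Defs.v *)
From HB Require Import structures.
From mathcomp Require Import all_boot all_order all_algebra.
From mathcomp Require Import all_classical all_reals all_analysis.

Set Implicit Arguments.
Unset Strict Implicit.
Unset Printing Implicit Defensive.

Import numFieldNormedType.Exports.

Local Open Scope classical_set_scope.

(* CL X is a record rather than a [set_type], so that it carries only the
   Vietoris topology and not one induced from [set X]. *)
Record CL (X : topologicalType) := MkCL {
  CL_set :> set X;
  CL_closed : closed CL_set;
  CL_nonempty : CL_set !=set0 }.

HB.instance Definition _ (X : topologicalType) := gen_eqMixin (CL X).
HB.instance Definition _ (X : topologicalType) := gen_choiceMixin (CL X).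

Definition vietoris_family (X : topologicalType) : set (set (set X)) :=
  [set U | [/\ finite_set U, U !=set0 &
               forall A, U A -> open A /\ A !=set0]].

Definition vietoris_base (X : topologicalType) (U : set (set X)) :
    set (CL X) :=
  [set F : CL X | F `<=` \bigcup_(A in U) A /\ forall A, U A -> (F `&` A) !=set0].

Section vietoris_topology.
Variable X : topologicalType.

Lemma vietoris_base_cover :
  \bigcup_(U in @vietoris_family X) @vietoris_base X U = setT.
Proof.
apply/seteqP; split=> // F _.
exists [set setT].
  split; [exact: finite_set1 | by exists setT |].
  move=> A ->; split; first exact: openT.
  by have [x _] := CL_nonempty F; exists x.
split; first by move=> x _; exists setT.
by move=> A ->; rewrite setIT; exact: CL_nonempty.
Qed.

Lemma vietoris_base_join (U V : set (set X)) (F : CL X) :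
  vietoris_family U -> vietoris_family V ->
  vietoris_base U F -> vietoris_base V F ->
  exists W, [/\ vietoris_family W, vietoris_base W F &
                vietoris_base W `<=` vietoris_base U `&` vietoris_base V].
Proof.
move=> [finU U0 oU] [finV V0 oV] [FU UF] [FV VF].
pose W := [set C | exists A B,
  [/\ U A, V B, C = A `&` B & (F `&` C) !=set0]].
have WF x : CL_set F x -> exists A B, [/\ U A, V B, A x, B x & W (A `&` B)].
  move=> Fx; have [A UA Ax] := FU _ Fx; have [B VB Bx] := FV _ Fx.
  exists A, B; split=> //; exists A, B; split=> //.
  by exists x.
exists W; split.
- split.
  + apply: (@sub_finite_set _ _ [set A `&` B | A in U & B in V]).
      by move=> C [A [B [UA VB -> _]]]; exists A => //; exists B.
    exact: finite_image2.
  + have [x /WF[A [B [_ _ _ _ WAB]]]] := CL_nonempty F.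
    by exists (A `&` B).
  + move=> C [A [B [UA VB -> [x [_ Cx]]]]]; split; last by exists x.
    by apply: openI; [have [] := oU _ UA | have [] := oV _ VB].
- split; last by move=> C [A [B []]].
  move=> x /WF[A [B [_ _ Ax Bx WAB]]].
  by exists (A `&` B).
- move=> G [GW WG]; split; split.
  + by move=> x /GW[_ [A [B [UA _ -> _]]] [Ax _]]; exists A.
  + move=> A UA; have [x [Fx Ax]] := UF _ UA.
    have [B VB Bx] := FV _ Fx.
    have /WG[y [Gy [Ay _]]] : W (A `&` B).
      by exists A, B; split=> //; exists x.
    by exists y.
  + by move=> x /GW[_ [A [B [_ VB -> _]]] [_ Bx]]; exists B.
  + move=> B VB; have [x [Fx Bx]] := VF _ VB.
    have [A UA Ax] := FU _ Fx.
    have /WG[y [Gy [_ By]]] : W (A `&` B).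
      by exists A, B; split=> //; exists x.
    by exists y.
Qed.

HB.instance Definition _ := isBaseTopological.Build (CL X)
  vietoris_base_cover vietoris_base_join.

End vietoris_topology.

(* [isolated S] is relative to the subspace S. *)
Definition nontrivial_convergent_sequence (X : topologicalType) (S : set X) :
    Prop :=
  (S #= [set: nat])%card /\
  exists x, S `\` isolated S = [set x] /\
            forall U, nbhs x U -> finite_set (S `\` U).

(* As a type, [Sc X] has the subspace topology inherited from [CL X]. *)
Definition Sc (X : topologicalType) : set (CL X) :=
  [set S : CL X | nontrivial_convergent_sequence S].

Definition frechet_urysohn (X : topologicalType) : Prop :=
  forall (A : set X) (x : X), closure A x ->
    exists u : nat -> X, (forall n, A (u n)) /\ u @ \oo --> x.

Definition discrete_space (X : topologicalType) : Prop :=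
  forall A : set X, open A.

(* Paths are functions on the whole line, of which only the restriction to
   [0, 1] (with its subspace topology) matters. *)
Definition pathwise_connected (R : realType) (T : topologicalType) : Prop :=
  forall x y : T, exists f : R -> T,
    [/\ {within `[0%R, 1%R], continuous f}, f 0%R = x & f 1%R = y].

(* Main.v *)
Require Import Defs.
From mathcomp Require Import all_boot all_order all_algebra.
From mathcomp Require Import all_classical all_reals all_analysis.
From mathcomp Require Import lra.

(** The heart of the proof is a path lifting theorem for hyperspaces: a path
    [f] of compact zero-dimensional subsets of a Hausdorff space, continuous
    for the Vietoris topology, admits through each point of [f 0] a continuous
    selection (lemmas [full_thread] and [thread_continuous]).

    Write [band F s t] for the graph of [F] over the segment [s, t], as a
    subset of [X * R]. It projects onto [s, t] by a map that is open (lower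
    semicontinuity) and proper (upper semicontinuity and compact fibres). The
    image of a clopen part of the band is therefore clopen in [s, t], hence
    everything, and compactness of the fibre over [t] yields for each point
    over [s] a point over [t] in the same quasi-component of the band
    (lemma [band_connected]). Iterating this along a finite grid gives
    selections whose values at the grid points lie pairwise in the same
    quasi-component of the band between them. Such selections form a nonempty
    closed set which shrinks as the grid is refined, so by Tychonoff's theorem
    some selection [c] has the property for all pairs of parameters. It is
    continuous: a small clopen piece of the fibre over [t] extends to a clopen
    piece of a short band around [t], and [c] cannot leave the latter.

    A convergent sequence is compact and zero-dimensional, so if [S] and [T]
    are points of the path-wise connected space [Sc X], each point of [S] is
    joined by a path of [X] to some point of [T] (lemma [Sc_path_lift]). Two
    applications conclude. With [T] a tail of [S] that avoids some point of
    [S], lifting from that point gives a nonconstant path in [X]; as [X] is Frechet-Urysohn, the range of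
    that path contains a nontrivial convergent sequence [T]. Every point of [X]
    lies on some nontrivial convergent sequence, thus is joined to a point of
    this new [T], and all points of [T] are joined to each other along the
    path. *)

Set Implicit Arguments.
Unset Strict Implicit.
Unset Printing Implicit Defensive.
Import Order.TTheory GRing.Theory Num.Theory.
Import numFieldNormedType.Exports.
Local Open Scope classical_set_scope.
Local Open Scope ring_scope.

(** * Compact sets and tubes *)

(** The tube lemma with one factor replaced by a filter. With [F] the
    neighbourhoods of a point it gives tubes around a fibre; with [F] the
    neighbourhoods of a set it separates compact sets. *)
Lemma compact_tube (T : topologicalType) (I : Type) (F : set_system I)
    (A : set T) (P : T -> I -> Prop) : Filter F -> compact A ->
  (forall x, A x -> \forall y \near x & i \near F, P y i) ->
  exists2 V, F V & exists O, [/\ open O, A `<=` O &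
    forall y i, O y -> V i -> P y i].
Proof.
move=> FF /compact_near_coveringP cA nearP.
(* [F] may be improper, as the neighbourhoods of an empty set are. *)
have [F0|nF0] := pselect (F set0).
  by exists set0 => //; exists setT; split=> //; exact: openT.
have {nF0}PF : ProperFilter F by [].
have /cA : forall x, A x -> \forall y \near x & V \near powerset_filter_from F,
    \forall z \near y, forall i, V i -> P z i.
  move=> x /nearP[[B W] /= [xB FW] BWP].
  exists (interior B, [set V | V `<=` W]); first split => /=.
  - exact: nbhs_interior.
  - exact: small_set_sub.
  - move=> [y V] /= [By VW]; apply: filterS By => z Bz i /VW Wi.
    exact: (BWP (z, i)).
move=> AP; have [V [FV VP]] := filter_ex (filterI (near_small_set PF) AP).
exists V => //; exists (interior [set z | forall i, V i -> P z i]); split.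
- exact: open_interior.
- by move=> x /VP.
- by move=> y i /interior_subset; apply.
Qed.

(** The tube lemma is used twice, for the relation of being distinct: first to
    separate [A] from a point of [B], then to separate it from all of [B]. *)
Lemma compact_disjoint_separated (T : topologicalType) (A B : set T) :
  hausdorff_space T -> compact A -> compact B -> A `&` B = set0 ->
  exists U V, [/\ open U, open V, A `<=` U, B `<=` V & U `&` V = set0].
Proof.
move=> hT cA cB AB0.
pose ne (y z : T) := y <> z.
have near_ne (x y : T) : x <> y -> \forall x' \near x & y' \near y, ne x' y'.
  move=> xy; have := hT; rewrite open_hausdorff => /(_ x y) [].
    exact/eqP.
  move=> [U V] /=; rewrite !inE => -[Ux Vy] [oU oV /eqP UV0].
  exists (U, V); first by split; apply: open_nbhs_nbhs.
  move=> [x' y'] /= [Ux' Vy'] E.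
  by have : (U `&` V) x'; [split=> //; rewrite E|rewrite (eqP UV0)].
have near_sep b : B b -> exists2 V, nbhs b V &
    exists O, [/\ open O, A `<=` O & forall y z, O y -> V z -> ne y z].
  move=> Bb; apply: compact_tube => // a Aa; apply: near_ne => ab.
  by have : (A `&` B) a; [split=> //; rewrite ab|rewrite AB0].
have [V AV [W [oW BW WV]]] : exists2 V, set_nbhs A V &
    exists O, [/\ open O, B `<=` O & forall y z, O y -> V z -> ne z y].
  apply: compact_tube => // b /near_sep[V bV [W [oW AW WV]]].
  exists (V, W); first by split=> //=; apply/set_nbhsP; exists W; split.
  by move=> [y z] /= [Vy Wz]; exact: WV.
have /set_nbhsP[U [oU AU UV]] := AV.
exists U, W; split=> //.
by apply/seteqP; split=> // x [/UV Vx Wx]; exact: (WV x x).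
Qed.

(** * Relatively clopen sets and quasi-components *)

(** Being clopen in the subspace [K], phrased as local constancy on [K] so
    that [C] need not be included in [K]. *)
Definition relclopen (T : topologicalType) (K C : set T) :=
  forall p, K p -> \forall q \near within K (nbhs p), C q <-> C p.

Lemma relclopen_sub (T : topologicalType) (K L C : set T) :
  K `<=` L -> relclopen L C -> relclopen K C.
Proof.
move=> KL clC p /KL/clC; rewrite !near_withinE.
by apply: filterS => q Cq /KL.
Qed.

Lemma relclopenI (T : topologicalType) (K C D : set T) :
  relclopen K C -> relclopen K D -> relclopen K (C `&` D).
Proof.
move=> clC clD p Kp; apply: filterS2 (clC p Kp) (clD p Kp) => q [a b] [c d].
by split=> -[? ?]; split; auto.
Qed.

Lemma relclopenC (T : topologicalType) (K C : set T) :
  relclopen K C -> relclopen K (~` C).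
Proof.
move=> clC p Kp; apply: filterS (clC p Kp) => q [a b].
by split=> + ?; apply; auto.
Qed.

Lemma connected_relclopen (T : topologicalType) (A B : set T) :
  connected A -> relclopen A B -> A `&` B !=set0 -> A `<=` B.
Proof.
move=> cA clB AB0; suff <- : A `&` B = A by move=> x [].
pose O (D : set T) := interior [set q | A q -> D q].
have OE D : relclopen A D -> A `&` D = A `&` O D.
  move=> clD; apply/seteqP; split=> p [Ap].
    move=> Dp; split=> //; have := clD p Ap; rewrite near_withinE.
    by apply: filterS => q qp Aq; apply/(qp Aq).
  by move=> /interior_subset/(_ Ap).
apply: cA => //.
- by exists (O B); [exact: open_interior|exact: OE].
- exists (~` O (~` B)); first exact/open_closedC/open_interior.
  have /seteqP[BO OB] := OE _ (relclopenC clB).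
  apply/seteqP; split=> p [Ap Bp]; split=> //.
    by move=> Op; have [] := OB p (conj Ap Op).
  by apply: contrapT => nBp; have [_] := BO p (conj Ap nBp).
Qed.

(** Lying in the same quasi-component of [K]: an intersection of clopen
    equivalence relations, hence a closed relation, which is what allows limits
    of coherent selections to be coherent. *)
Definition quasi_connected (T : topologicalType) (K : set T) (p q : T) :=
  forall C, relclopen K C -> C p -> C q.

Lemma quasi_connected_sym (T : topologicalType) (K : set T) (p q : T) :
  quasi_connected K p q -> quasi_connected K q p.
Proof.
move=> pq C clC Cq; apply: contrapT => nCp.
exact: (pq _ (relclopenC clC) nCp).
Qed.

Lemma quasi_connected_sub (T : topologicalType) (K L : set T) (p q : T) :
  K `<=` L -> quasi_connected K p q -> quasi_connected L p q.
Proof. by move=> KL pq C /(relclopen_sub KL); exact: pq. Qed.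

Lemma quasi_connected_trans (T : topologicalType) (K : set T) (p q r : T) :
  quasi_connected K p q -> quasi_connected K q r -> quasi_connected K p r.
Proof. by move=> pq qr C clC /(pq _ clC)/(qr _ clC). Qed.

(** If no point of [L] shared the quasi-component of [p], then, the relatively
    clopen sets containing [p] being stable under intersection, by compactness
    one of them would miss [L]. *)
Lemma quasi_connected_compact (T : topologicalType) (K L : set T) (p : T) :
  compact L -> L `<=` K ->
  (forall C, relclopen K C -> C p -> L `&` C !=set0) ->
  exists2 q, L q & quasi_connected K p q.
Proof.
move=> cL LK meetC.
pose F := filter_from [set C | relclopen K C /\ C p] (fun C => L `&` C).
have FF : ProperFilter F.
  apply: filter_from_proper; last by move=> C [clC Cp]; exact: meetC.
  apply: filter_from_filter; first by exists setT; split=> // x _; near=> z.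
  move=> C D [clC Cp] [clD Dp]; exists (C `&` D).
    by split=> //; exact: relclopenI.
  by move=> x [Lx [Cx Dx]].
have FL : F L by exists setT; [split=> // x _; near=> z|move=> x []].
have [q [Lq clq]] := cL F FF FL.
exists q => // C clC Cp; apply: contrapT => nCq.
have FC : F (L `&` C) by exists C.
have [x [[Lx Cx] /= /(_ (LK _ Lx)) xq]] := clq _ _ FC (clC q (LK q Lq)).
exact/nCq/xq.
Unshelve. all: by end_near. Qed.

Lemma quasi_connected_closed (T : topologicalType) (K : set T) (p q : T) :
  K p -> K q ->
  (forall U V, nbhs p U -> nbhs q V ->
    exists p' q', [/\ (K `&` U) p', (K `&` V) q' & quasi_connected K p' q']) ->
  quasi_connected K p q.
Proof.
move=> Kp Kq lim C clC Cp.
have [p' [q' [[Kp' pp'] [Kq' qq'] pq']]] := lim _ _ (clC p Kp) (clC q Kq).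
apply/(qq' Kq'); apply: pq' => //; exact/(pp' Kp').
Qed.

(** * Bands of a path of compact sets *)

(** Upper and lower semicontinuity: continuity of a set-valued map for the
    Vietoris topology. *)
Definition vietoris_continuous (T X : topologicalType) (F : T -> set X) :=
  (forall t U, open U -> F t `<=` U -> \forall r \near t, F r `<=` U) /\
  (forall t U, open U -> F t `&` U !=set0 ->
    \forall r \near t, F r `&` U !=set0).

Definition band (R : realType) (X : topologicalType) (F : R -> set X)
    (s t : R) : set (X * R) :=
  [set p | p.2 \in `[s, t] /\ F p.2 p.1].

(** A relatively clopen part of the band projects onto a relatively clopen part
    of the segment, which is connected. *)
Lemma band_connected (R : realType) (X : topologicalType) (F : R -> set X)
    (s t : R) (x : X) :
  vietoris_continuous F -> (forall r, compact (F r)) -> s <= t -> F s x ->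
  exists2 y, F t y & quasi_connected (band F s t) (x, s) (y, t).
Proof.
move=> [usc lsc] cF st Fsx.
have [||C clC Cxs|[y r] [/= Fty ->] xy] := @quasi_connected_compact _
  (band F s t) (F t `*` [set t]) (x, s); last by exists y.
- by apply: compact_setX => //; exact: compact_set1.
- by move=> [y r] [/= Fty ->]; split=> //=; rewrite in_itv /= st lexx.
pose D := [set r | exists2 z, F r z & C (z, r)].
suff /(_ t) [] : `[s, t] `<=` D.
- by rewrite /= in_itv /= st lexx.
- by move=> z Ftz Czt; exists (z, t).
apply: connected_relclopen.
- exact: segment_connected.
- move=> r rst; have [[z Frz Czr]|nDr] := pselect (D r).
    have Kzr : band F s t (z, r) by [].
    have [[U N] /= [zU rN] UNC] := clC _ Kzr.
    have := lsc r (interior U) (open_interior U) _.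
    move=> /(_ (ex_intro _ z (conj Frz zU))) nearU.
    rewrite near_withinE; near=> r' => r'st; split=> [_|_]; first by exists z.
    have [z' [Frz' /interior_subset Uz']] : F r' `&` interior U !=set0.
      by near: r'.
    have Nr' : N r' by near: r'.
    by exists z' => //; apply/(UNC (z', r')).
  have [|N rN [U [oU FU UN]]] := @compact_tube X R (nbhs r) (F r)
    (fun z r' => band F s t (z, r') -> ~ C (z, r')) _ (cF r).
    move=> z Frz; apply: filterS (clC (z, r) (conj rst Frz)) => -[z' r'] /= CC.
    by move=> /CC Czr; apply: nDr; exists z.
  rewrite near_withinE; near=> r' => r'st; split=> // -[z Frz Czr].
  have FrU : F r' `<=` U by near: r'; exact: usc.
  have Nr' : N r' by near: r'.
  by case: (UN z r' (FrU _ Frz) Nr').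
- exists s; split; last by exists x.
  by rewrite /= in_itv /= st lexx.
Unshelve. all: by end_near. Qed.

Lemma band_sub (R : realType) (X : topologicalType) (F : R -> set X)
    (s t s' t' : R) : s' <= s -> t <= t' -> band F s t `<=` band F s' t'.
Proof.
move=> ss tt [x r] [/=]; rewrite in_itv /= => /andP[sr rt] Fx.
by split=> //=; rewrite in_itv /= (le_trans ss sr) (le_trans rt tt).
Qed.

(** * Threads: coherent selections *)

(** Going along the grid [a :: l], each value is chosen over the next grid
    point by [band_connected]. Coherence for nonconsecutive grid points is then
    transitivity. *)
Lemma finite_thread (R : realType) (X : topologicalType) (F : R -> set X)
    (l : seq R) (a : R) (p : X) :
  vietoris_continuous F -> (forall r, compact (F r)) ->
  (forall r, F r !=set0) -> path <%R a l -> F a p ->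
  exists c : R -> X, [/\ forall r, F r (c r), c a = p &
    forall s t, s \in a :: l -> t \in a :: l -> s < t ->
      quasi_connected (band F s t) (c s, s) (c t, t)].
Proof.
move=> cF kF F0; elim: l a p => [|b l IH] a p /=.
  move=> _ Fap; exists (fun r => if r == a then p else xget p (F r)).
  split=> [r||s t]; rewrite ?eqxx //.
    case: eqP => [->//|_]; have [x Fx] := F0 r.
    exact: (xgetPex p (ex_intro _ x Fx)).
  by rewrite !inE => /eqP-> /eqP->; rewrite ltxx.
move=> /andP[ab bl] Fap.
have [q Fbq pq] := band_connected cF kF (ltW ab) Fap.
have [c [Fc cb cbl]] := IH b q bl Fbq.
have lt_a t : t \in b :: l -> a < t.
  rewrite inE => /orP[/eqP->//|tl]; apply: (lt_trans ab).
  by move: bl => /(order_path_min lt_trans)/allP/(_ _ tl).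
exists (fun r => if r == a then p else c r); split=> [r||s t].
- by case: eqP => [->|].
- by rewrite eqxx.
rewrite (in_cons a (b :: l)) (in_cons a (b :: l)).
have [->|sa] := eqVneq s a => /= [_|sbl].
  have [->|ta] := eqVneq t a => /= [_|tbl]; first by rewrite ltxx.
  move=> _; have bt : b <= t.
    move: tbl; rewrite inE => /orP[/eqP->//|tl].
    by move: bl => /(order_path_min lt_trans)/allP/(_ _ tl)/ltW.
  have pqa : quasi_connected (band F a t) (p, a) (q, b).
    by apply: quasi_connected_sub pq; exact: band_sub.
  move: bt; rewrite le_eqVlt => /predU1P[bt|bt].
    by rewrite -bt cb {1}bt.
  apply: quasi_connected_trans pqa _.
  have := cbl b t; rewrite mem_head cb => /(_ isT tbl bt).
  by apply: quasi_connected_sub; apply: band_sub => //; exact: ltW.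
have [->|ta] := eqVneq t a => /= [_|tbl].
  by move=> /(lt_trans (lt_a _ sbl)); rewrite ltxx.
exact: cbl.
Qed.

(** Coherence is required at nonnegative parameters only, as values are
    prescribed at [0] and propagated to the right. *)
Lemma full_thread (R : realType) (X : topologicalType) (F : R -> set X)
    (p : X) :
  hausdorff_space X -> vietoris_continuous F -> (forall r, compact (F r)) ->
  (forall r, F r !=set0) -> F 0 p ->
  exists c : R -> X, [/\ forall r, F r (c r), c 0 = p &
    forall s t, 0 <= s -> s < t ->
      quasi_connected (band F s t) (c s, s) (c t, t)].
Proof.
move=> hX cF kF F0 F0p.
pose thread (l : seq R) : set {ptws R -> X} := [set c | [/\ forall r, F r (c r),
  c 0 = p & forall s t, s \in l -> t \in l -> 0 <= s -> s < t ->
    quasi_connected (band F s t) (c s, s) (c t, t)]].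
have thread0 l : thread l !=set0.
  (* The grid [l] is turned into an increasing one that starts at [0]. *)
  pose l' := sort <=%R (undup [seq x <- l | 0 < x]).
  have pl' : path <%R 0 l'.
    have : sorted <%R (0 :: l').
      rewrite lt_sorted_uniq_le /= sort_uniq undup_uniq mem_sort mem_undup.
      rewrite mem_filter ltxx /= path_min_sorted ?sort_le_sorted //.
      by apply/allP => x; rewrite mem_sort mem_undup mem_filter => /andP[/ltW].
    by [].
  have meml' t : 0 <= t -> t \in l -> t \in 0 :: l'.
    rewrite le_eqVlt => /predU1P[<-|t0] tl; first exact: mem_head.
    by rewrite inE mem_sort mem_undup mem_filter t0 tl orbT.
  have [c [Fc c0 cl]] := finite_thread cF kF F0 pl' F0p.
  exists c; split=> // s t sl tl s0 st; apply: cl => //; apply: meml' => //.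
  exact: le_trans (ltW st).
pose G := filter_from setT thread.
have GF : ProperFilter G.
  apply: filter_from_proper; last by move=> l _; exact: thread0.
  apply: filter_from_filter; first by exists [::].
  move=> k l _ _; exists (k ++ l) => // c [Fc c0 ckl].
  by split; split=> // s t sl tl; apply: ckl; rewrite mem_cat ?sl ?tl ?orbT.
have GA : G [set c : {ptws R -> X} | forall r, F r (c r)].
  by exists [::] => // c [].
(* [c] is adherent to each [thread l]; the remaining steps say that these
   sets are closed. *)
have [c [Fc clc]] := tychonoff kF GF GA.
have near_c t U : nbhs (c t) U -> nbhs (c : {ptws R -> X}) [set d | U (d t)].
  exact: (@proj_continuous R (fun=> X) t).
exists c; split=> //.
- apply: hX => U V cU pV.
  have [d [[_ d0 _] Ud]] := clc _ _ (ex_intro2 _ _ [::] I (fun=> id))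
    (near_c 0 U cU).
  by exists p; split; [rewrite -d0|exact: nbhs_singleton].
- move=> s t s0 st; apply: quasi_connected_closed.
  + by split=> //=; rewrite in_itv /= lexx ltW.
  + by split=> //=; rewrite in_itv /= lexx ltW.
  move=> U V [[U1 U2] /= [cU1 sU2] U12] [[V1 V2] /= [cV1 tV2] V12].
  have Gst : G (thread [:: s; t]) by exists [:: s; t].
  have cUV : nbhs (c : {ptws R -> X}) [set d | U1 (d s) /\ V1 (d t)].
    have Fc' := nbhs_filter (c : {ptws R -> X}).
    exact: (@filterI _ _ Fc' _ _ (near_c s U1 cU1) (near_c t V1 cV1)).
  have [d [[Fd d0 dst] [/= Ud Vd]]] := clc _ _ Gst cUV.
  exists (d s, s), (d t, t); split.
  + split; first by split=> //=; rewrite in_itv /= lexx ltW.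
    by apply: U12; split=> //=; exact: nbhs_singleton.
  + split; first by split=> //=; rewrite in_itv /= lexx ltW.
    by apply: V12; split=> //=; exact: nbhs_singleton.
  + by apply: dst => //; rewrite !inE eqxx ?orbT.
Qed.

(** * Continuity of threads *)

(** In a Hausdorff space the two compact pieces are clopen in [S], so this says
    that [S] is compact with a base of clopen sets; compactness is the form in
    which clopenness serves to separate the pieces by open sets of [X]. *)
Definition zero_dimensional (X : topologicalType) (S : set X) :=
  forall x U, S x -> nbhs x U -> exists A B,
    [/\ compact A, compact B, A `&` B = set0, S = A `|` B & A x /\ A `<=` U].

Lemma band_split (R : realType) (X : topologicalType) (F : R -> set X)
    (s t : R) (U V : set X) :
  open U -> open V -> U `&` V = set0 ->
  (forall r, r \in `[s, t] -> F r `<=` U `|` V) ->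
  relclopen (band F s t) [set p | U p.1].
Proof.
move=> oU oV UV0 FUV [z r] [/= rst Fz].
have near1 W : open W -> W z ->
    \forall q \near within (band F s t) (nbhs (z, r)), W q.1.
  move=> oW Wz; rewrite near_withinE.
  exists (W, setT); first by split; [exact: open_nbhs_nbhs|exact: filterT].
  by move=> q [].
have nUV y : U y -> V y -> False.
  by move=> Uy Vy; have : (U `&` V) y; [split|rewrite UV0].
have [Uz|Vz] := FUV r rst z Fz.
  by apply: filterS (near1 U oU Uz).
by apply: filterS (near1 V oV Vz) => q Vq; split=> /nUV; [case/(_ Vq)|case/(_ Vz)].
Qed.

(** Near [t] the fibres lie in the union of two disjoint open sets [U'] and [V]
    that split the fibre over [t], with [U'] small around [c t]; coherence
    between [s] and [t] forces [c s] to lie in [U']. *)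
Lemma thread_continuous (R : realType) (X : topologicalType) (F : R -> set X)
    (c : R -> X) :
  hausdorff_space X -> vietoris_continuous F ->
  (forall r, zero_dimensional (F r)) -> (forall r, F r (c r)) ->
  (forall s t, 0 <= s -> s < t ->
      quasi_connected (band F s t) (c s, s) (c t, t)) ->
  {within `[0, 1], continuous c}.
Proof.
move=> hX [usc lsc] zF Fc cc; apply/subspace_continuousP => t t01 W cW.
have [A [B [cA cB AB0 FAB [Act AW]]]] := zF t (c t) _ (Fc t) (nbhs_interior cW).
have [U [V [oU oV AU BV UV0]]] := compact_disjoint_separated hX cA cB AB0.
pose U' := U `&` interior W.
have oU' : open U' by apply: openI => //; exact: open_interior.
have AU' : A `<=` U' by move=> x Ax; split; [exact: AU|exact: AW].
have UV0' : U' `&` V = set0.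
  by apply/seteqP; split=> // x [[Ux _] Vx]; rewrite -UV0.
have FtUV : F t `<=` U' `|` V.
  by rewrite FAB => x [/AU'|/BV]; [left|right].
have /nbhs_ballP[e /= e0 eUV] := usc t _ (openU oU' oV) FtUV.
suff near_t s : s \in `[0, 1] -> ball t e s -> U' (c s).
  suff : \forall s \near within `[0, 1] (nbhs t), W (c s) by [].
  rewrite near_withinE; near=> s => s01.
  apply: interior_subset; suff [] : U' (c s) by [].
  by apply: near_t => //; near: s; exact: nbhsx_ballx.
move=> s01 ts.
have ball_between r : Num.min s t <= r <= Num.max s t -> ball t e r.
  move: ts; rewrite /ball /= !ltr_norml.
  move=> /andP[? ?] /andP[]; rewrite ge_min le_max => /orP[?|?] /orP[?|?];
  apply/andP; split; lra.
have [st|ts'|->] := ltgtP s t; last exact: AU'.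
- have clU : relclopen (band F s t) [set p | U' p.1].
    apply: band_split oV UV0' _ => // r; rewrite in_itv /= => rst.
    apply: eUV; apply: ball_between.
    by rewrite (min_idPl (ltW st)) (max_idPr (ltW st)).
  have s0 : 0 <= s by move: s01; rewrite in_itv => /andP[].
  exact: (quasi_connected_sym (cc s t s0 st)) clU (AU' _ Act).
- have clU : relclopen (band F t s) [set p | U' p.1].
    apply: band_split oV UV0' _ => // r; rewrite in_itv /= => rst.
    apply: eUV; apply: ball_between.
    by rewrite (min_idPr (ltW ts')) (max_idPl (ltW ts')).
  have t0 : 0 <= t by move: t01; rewrite /= in_itv => /andP[].
  exact: (cc t s t0 ts') clU (AU' _ Act).
Unshelve. all: by end_near. Qed.

(** * Nontrivial convergent sequences *)

(** The part of the definition of a convergent sequence that gives compactness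
    and zero-dimensionality. Finite sets are allowed, which makes the property
    inherited by the subsets that contain [p]. *)
Definition clusters_only_at (X : topologicalType) (p : X) (S : set X) :=
  S p /\ forall U, nbhs p U -> finite_set (S `\` U).

Lemma clusters_only_at_compact (X : topologicalType) (p : X) (S : set X) :
  clusters_only_at p S -> compact S.
Proof.
move=> [Sp finS] F FF FS.
have [cFp|/existsNP[A /existsNP[U]]] := pselect (cluster F p).
  by exists p.
move=> /not_implyP[FA /not_implyP[pU AU0]].
have FSU : F (S `\` U).
  apply: filterS (filterI FA FS) => x [Ax Sx]; split=> // Ux.
  by apply: AU0; exists x.
have [x [[Sx _] Fx]] := finite_compact (finS U pU) FF FSU.
by exists x.
Qed.

Lemma clusters_only_at_sub (X : topologicalType) (p : X) (S T : set X) :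
  T `<=` S -> T p -> clusters_only_at p S -> clusters_only_at p T.
Proof.
move=> TS Tp [_ finS]; split=> // U /finS; apply: sub_finite_set.
exact: setSD.
Qed.

(** A point [x] different from [p] splits off as a singleton; around [p] the
    complement of a neighbourhood is finite. In both cases the piece containing
    [p] is compact because it still clusters only at [p]. *)
Lemma clusters_only_at_zero_dimensional (X : topologicalType) (p : X)
    (S : set X) : clusters_only_at p S -> zero_dimensional S.
Proof.
move=> pS x U Sx xU; have [xp|/eqP xp] := eqVneq x p.
- subst x; exists (S `&` U), (S `\` U); split.
  + apply: clusters_only_at_compact (clusters_only_at_sub _ _ pS) => [y []//|].
    by split=> //; exact: nbhs_singleton.
  + by apply: finite_compact; case: pS => _; apply.
  + by rewrite setDE setIACA setICr setI0.
  + by rewrite setUIDK.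
  + by split=> [|y []//]; split=> //; exact: nbhs_singleton.
- exists [set x], (S `\` [set x]); split.
  + exact: compact_set1.
  + apply: clusters_only_at_compact (clusters_only_at_sub _ _ pS) => [y []//|].
    by split; [case: pS|exact/nesym].
  + by rewrite setDE setICA setICr setI0.
  + by rewrite setDUK // => _ ->.
  + by split=> // _ ->; exact: nbhs_singleton.
Qed.


Lemma nontrivial_convergent_sequenceP (X : topologicalType) (S : set X) :
  nontrivial_convergent_sequence S -> exists p, clusters_only_at p S.
Proof.
move=> [_ [p [Sp fin]]]; exists p; split=> //.
by have [] : (S `\` isolated S) p by rewrite Sp.
Qed.

Definition limit_range (X : Type) (p : X) (u : nat -> X) := p |` range u.

Lemma limit_range_clusters (X : topologicalType) (p : X) (u : nat -> X) :
  u @ \oo --> p -> clusters_only_at p (limit_range p u).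
Proof.
move=> up; split=> [|U pU]; first by left.
have [N _ NU] := up U pU.
apply: (@sub_finite_set _ _ (u @` `I_N)); last exact/finite_image/finite_II.
move=> _ [[->|[n _ <-]] nU]; first by case: nU; exact: nbhs_singleton.
by exists n => //=; rewrite ltnNge; apply/negP => /NU.
Qed.

(** A finite range would be closed, and its complement a neighbourhood of [p]
    that the sequence never enters. *)
Lemma limit_range_infinite (X : topologicalType) (p : X) (u : nat -> X) :
  hausdorff_space X -> u @ \oo --> p -> (forall n, u n <> p) ->
  infinite_set (range u).
Proof.
move=> hX up u_p /finite_compact/(compact_closed hX)/closed_openC oU.
have : nbhs p (~` range u) by apply: open_nbhs_nbhs; split=> // -[n _ /u_p].
by move=> /up[N _ /(_ N (leqnn N))]; apply; exists N.
Qed.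

(** Values of [u] may repeat, but only finitely often since they differ from the
    limit; hence there are infinitely many of them, each isolated. *)
Lemma limit_range_Sc (X : topologicalType) (p : X) (u : nat -> X) :
  hausdorff_space X -> u @ \oo --> p -> (forall n, u n <> p) ->
  exists S : CL X, Sc S /\ CL_set S = limit_range p u.
Proof.
move=> hX up u_p; have pS := limit_range_clusters up.
have closedS := compact_closed hX (clusters_only_at_compact pS).
have S0 : limit_range p u !=set0 by exists p; left.
exists (MkCL closedS S0); split=> //; split=> /=.
  rewrite card_eq_sym; apply/card_eqPle; split.
    apply/infiniteP => /(sub_finite_set (@subsetUr _ [set p] _)).
    exact: (limit_range_infinite hX up u_p).
  have -> : limit_range p u = range (fun n => if n is m.+1 then u m else p).
    apply/seteqP; split=> [x [->|[n _ <-]]|x [[|n] _ <-]].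
    - by exists 0%N.
    - by exists n.+1.
    - by left.
    - by right; exists n.
  exact: card_image_le.
exists p; split; last by case: pS.
apply/seteqP; split=> [x [Sx nix]|_ ->].
  apply: contrapT => xp; apply: nix; split; first exact/mem_set.
  (* Deleting [x] leaves a compact, hence closed, set. *)
  exists (~` (limit_range p u `\` [set x])).
    apply: open_nbhs_nbhs; split; last by move=> [_]; apply.
    apply/closed_openC/(compact_closed hX).
    apply: clusters_only_at_compact (clusters_only_at_sub _ _ pS) => [y []//|].
    by split; [left|exact/nesym].
  apply/seteqP; split=> [y [nSx Sy]|_ ->]; last by split=> // -[_]; apply.
  by apply: contrapT => yx; apply: nSx.
split; first by left.
move=> [_ [V /up[N _ /(_ N (leqnn N)) VuN] VS]].
have : (V `&` limit_range p u) (u N) by split=> //; right; exists N.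
by rewrite VS => /u_p.
Qed.

(** * Paths in the hyperspace and in the space *)

Lemma vietoris_base_open (X : topologicalType) (U : set (set X)) :
  vietoris_family U -> open (@vietoris_base X U).
Proof.
move=> fU; exists [set U]; first by move=> _ ->.
by rewrite bigcup_set1.
Qed.

Lemma CL_vietoris_continuous (T X : topologicalType) (f : T -> CL X) :
  continuous f -> vietoris_continuous (fun t => CL_set (f t)).
Proof.
move=> cf; split=> t U oU.
- move=> ftU; have [x fx] := CL_nonempty (f t).
  have fU : vietoris_family [set U].
    split; [exact: finite_set1|by exists U|move=> _ ->].
    by split=> //; exists x; exact: ftU.
  have : nbhs (f t) (@vietoris_base X [set U]).
    apply: open_nbhs_nbhs; split; first exact: vietoris_base_open.
    by split=> [y /ftU Uy|_ ->]; [exists U|exists x; split=> //; exact: ftU].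
  move=> /cf nearU.
  have {}nearU : \forall r \near t, @vietoris_base X [set U] (f r) by [].
  by apply: filterS nearU => r [fr _] y /fr[_ ->].
- move=> [x [fx Ux]].
  have fU : vietoris_family [set U; setT].
    split; [exact: finite_set2|by exists U; left|].
    by move=> _ [|]->; split=> //; [exists x|exact: openT|exists x].
  have : nbhs (f t) (@vietoris_base X [set U; setT]).
    apply: open_nbhs_nbhs; split; first exact: vietoris_base_open.
    by split=> [y _|_ [|]->]; [exists setT => //; right|exists x|exists x].
  move=> /cf nearU.
  have {}nearU : \forall r \near t, @vietoris_base X [set U; setT] (f r).
    by [].
  by apply: filterS nearU => r [_ fr]; apply: fr; left.
Qed.

(** Continuity is required on the whole line, which makes reparametrization and
    concatenation free of side conditions; a path on the unit interval extends
    by constants on both sides (lemma [within_path_joined]). *)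
Definition path_joined (R : realType) (T : topologicalType) (x y : T) :=
  exists f : R -> T, [/\ continuous f, f 0 = x & f 1 = y].

Definition clamp01 (R : realType) (r : R) := Num.max 0 (Num.min r 1).

Lemma clamp01_itv (R : realType) (r : R) : clamp01 r \in `[0, 1].
Proof.
by rewrite in_itv /= /clamp01 le_max lexx /= ge_max ler01 ge_min lexx orbT.
Qed.

Lemma clamp01_id (R : realType) (r : R) : r \in `[0, 1] -> clamp01 r = r.
Proof.
by rewrite in_itv /= => /andP[r0 r1]; rewrite /clamp01 (min_idPl r1) (max_idPr r0).
Qed.

Lemma clamp01_continuous (R : realType) : continuous (@clamp01 R : R -> R).
Proof.
move=> r.
have ccst (x : R) : {for r, continuous (fun=> x : R^o)} by exact: cvg_cst.
have cmin := @continuous_min R R id (fun=> 1) r (fun A => id) (ccst 1).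
exact: (@continuous_max R R (fun=> 0) (fun r => Num.min r 1) r (ccst 0) cmin).
Qed.

Lemma comp_clamp01_continuous (R : realType) (T : topologicalType)
    (f : R -> T) : {within `[0, 1], continuous f} -> continuous (f \o @clamp01 R).
Proof.
move=> /subspace_continuousP cf r W /= fW.
have /clamp01_continuous nearW := cf _ (clamp01_itv r) W fW.
have {}nearW : \forall s \near r,
    clamp01 s \in `[0, 1] -> W (f (clamp01 s)) by [].
suff : \forall s \near r, W (f (clamp01 s)) by [].
by apply: filterS nearW => s; apply; exact: clamp01_itv.
Qed.

Lemma within_path_joined (R : realType) (T : topologicalType) (f : R -> T) :
  {within `[0, 1], continuous f} -> path_joined R (f 0) (f 1).
Proof.
move=> cf; exists (f \o @clamp01 R); split.
- exact: comp_clamp01_continuous.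
- by rewrite /= clamp01_id // in_itv /= lexx ler01.
- by rewrite /= clamp01_id // in_itv /= lexx ler01.
Qed.

Lemma path_joined_range (R : realType) (T : topologicalType) (f : R -> T)
    (a b : R) : continuous f -> path_joined R (f a) (f b).
Proof.
move=> cf; exists (fun t => f (a + (b - a) * t)); split.
- move=> t; apply: continuous_comp; last exact: cf.
  by apply: cvgD; [exact: cvg_cst|apply: cvgM; [exact: cvg_cst|exact: cvg_id]].
- by rewrite mulr0 addr0.
- by rewrite mulr1 addrC subrK.
Qed.

Lemma path_joined_sym (R : realType) (T : topologicalType) (x y : T) :
  path_joined R x y -> path_joined R y x.
Proof. by move=> [f [cf <- <-]]; exact: path_joined_range. Qed.

Lemma path_joined_trans (R : realType) (T : topologicalType) (x y z : T) :
  path_joined R x y -> path_joined R y z -> path_joined R x z.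
Proof.
move=> [f [cf fx fy]] [g [cg gy gz]].
pose h (t : R) := if t <= 2^-1 then f (2 * t) else g (2 * t - 1).
have cf' : continuous ((fun t => f (2 * t)) : R -> T).
  move=> t; apply: continuous_comp; last exact: cf.
  by apply: cvgM; [exact: cvg_cst|exact: cvg_id].
have cg' : continuous ((fun t => g (2 * t - 1)) : R -> T).
  move=> t; apply: continuous_comp; last exact: cg.
  apply: cvgB; last exact: cvg_cst.
  by apply: cvgM; [exact: cvg_cst|exact: cvg_id].
have <- : h 0 = x by rewrite /h invr_ge0 ler0n mulr0.
have <- : h 1 = z.
  rewrite /h ifF; last by apply/negbTE; rewrite -ltNge; lra.
  by rewrite -gz; congr g; lra.
apply/path_joined_range/continuous_subspace_setT.
have -> : [set: R] = [set t | t <= 2^-1] `|` [set t | 2^-1 <= t].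
  by apply/seteqP; split=> // t _ /=; apply/orP; exact: le_total.
apply: withinU_continuous; [exact: closed_le|exact: closed_ge| |].
- apply: subspace_eq_continuous (continuous_subspaceT cf') => t.
  by rewrite inE /from_subspace /h /= => ->.
- apply: subspace_eq_continuous (continuous_subspaceT cg') => t.
  rewrite inE /from_subspace /h /= le_eqVlt => /predU1P[<-|t2].
    by rewrite lexx divff ?pnatr_eq0 // subrr fy gy.
  by rewrite leNgt t2.
Qed.

Lemma hyperspace_path_lift (R : realType) (X : topologicalType)
    (f : R -> set_type (@Sc X)) (x : X) :
  hausdorff_space X -> {within `[0, 1], continuous f} ->
  CL_set (set_val (f 0)) x ->
  exists2 y, CL_set (set_val (f 1)) y & path_joined R x y.
Proof.
move=> hX cf f0x; pose g r := set_val (f (clamp01 r)).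
have cg : continuous g.
  move=> r; apply: (@continuous_comp _ _ _ (f \o @clamp01 R) set_val).
    exact: comp_clamp01_continuous.
  exact: initial_continuous.
have g01 r : r \in `[0, 1] -> g r = set_val (f r).
  by move=> r01; rewrite /g clamp01_id.
pose F r := CL_set (g r).
have cF : vietoris_continuous F by exact: CL_vietoris_continuous.
have limF r : exists p, clusters_only_at p (F r).
  apply: nontrivial_convergent_sequenceP.
  by have /set_mem := valP (f (clamp01 r)).
have kF r : compact (F r).
  by have [p] := limF r; exact: clusters_only_at_compact.
have zF r : zero_dimensional (F r).
  by have [p] := limF r; exact: clusters_only_at_zero_dimensional.
have F0x : F 0 x by rewrite /F g01 // in_itv /= lexx ler01.
have [c [Fc <- cc]] := full_thread hX cF kF (fun r => CL_nonempty (g r)) F0x.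
exists (c 1).
  by rewrite -g01 ?in_itv /= ?lexx ?ler01 //; exact: Fc.
apply: within_path_joined; exact: thread_continuous cc.
Qed.

(** If [f 0] were isolated in the connected range of [f], the range would be a
    singleton; otherwise the Frechet-Urysohn property applies to the rest of
    the range. *)
Lemma path_range_limit (R : realType) (X : topologicalType) (f : R -> X) :
  hausdorff_space X -> frechet_urysohn X -> continuous f -> f 0 <> f 1 ->
  exists u : nat -> R, f \o u @ \oo --> f 0 /\ forall n, f (u n) <> f 0.
Proof.
move=> hX fuX cf f01.
suff /fuX[v [Ev vf0]] : closure (range f `\` [set f 0]) (f 0).
  have /choice[u uv] : forall n, exists r, f r = v n.
    by move=> n; have [[r _ fr] _] := Ev n; exists r.
  exists u; split; last by move=> n; rewrite uv; have [] := Ev n.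
  by have -> : f \o u = v by apply/funext => n; rewrite /= uv.
apply: contrapT => ncl; apply: f01; apply/esym.
have [U f0U EU0] : exists2 U, nbhs (f 0) U &
    forall y, range f y -> U y -> y = f 0.
  move/existsNP: ncl => [U /not_implyP[f0U EU]]; exists U => // y fy Uy.
  by apply: contrapT => yf0; apply: EU; exists y.
suff : range f `<=` [set f 0] by apply; exists 1.
apply: connected_relclopen.
- apply: connected_continuous_connected; last exact: continuous_subspaceT.
  by apply/connected_intervalP => ? ?.
- move=> y fy; rewrite near_withinE; have [->|/eqP yf0] := eqVneq y (f 0).
    by apply: filterS f0U => z Uz fz; split=> //= _; exact: EU0.
  have : nbhs y (~` [set f 0]).
    apply: open_nbhs_nbhs; split=> //; apply/closed_openC.
    exact/accessible_closed_set1/hausdorff_accessible.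
  by apply: filterS => z zf0 _; split.
- by exists (f 0); split=> //; exists 0.
Qed.

(** * Path-wise connectedness of the space *)

Lemma nondiscrete_sequence (X : topologicalType) :
  ~ discrete_space X -> frechet_urysohn X ->
  exists p u, u @ \oo --> p /\ forall n : nat, u n <> p :> X.
Proof.
move=> nd fuX.
suff [p /fuX[u [unp up]]] : exists p : X, closure (~` [set p]) p by exists p, u.
apply: contrapT => iso; apply: nd => A.
have -> : A = \bigcup_(x in A) [set x].
  by apply/seteqP; split=> [x Ax|x [y Ay ->]//]; exists x.
apply: bigcup_open => x _; rewrite openE => _ ->.
apply: contrapT => nx; apply: iso; exists x => U xU.
apply: contrapT => Ux; apply: nx; apply: filterS xU => y Uy.
by apply: contrapT => yx; apply: Ux; exists y.
Qed.

(** Prepending a point to a convergent sequence yields a convergent sequence, so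
    a single nontrivial sequence provides one through each point. *)
Lemma Sc_through (X : topologicalType) (x : X) :
  hausdorff_space X -> ~ discrete_space X -> frechet_urysohn X ->
  exists2 S : CL X, Sc S & CL_set S x.
Proof.
move=> hX nd fuX; have [p [u [up u_p]]] := nondiscrete_sequence nd fuX.
have [->|/eqP xp] := eqVneq x p.
  by have [S [ScS SE]] := limit_range_Sc hX up u_p; exists S; rewrite ?SE; [|left].
pose v n := if n is m.+1 then u m else x.
have vp : v @ \oo --> p by move=> U /up[N _ NU]; exists N.+1 => // -[//|n] /NU.
have v_p n : v n <> p by case: n.
have [S [ScS SE]] := limit_range_Sc hX vp v_p; exists S => //.
by rewrite SE; right; exists 0%N.
Qed.

Lemma Sc_path_lift (R : realType) (X : topologicalType) (S T : CL X) (x : X) :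
  hausdorff_space X -> pathwise_connected R (set_type (@Sc X)) ->
  Sc S -> Sc T -> CL_set S x -> exists2 y, CL_set T y & path_joined R x y.
Proof.
move=> hX pc ScS ScT Sx.
have [f [cf f0 f1]] := pc (SigSub (mem_set ScS)) (SigSub (mem_set ScT)).
have [|y f1y xy] := @hyperspace_path_lift R X f x hX cf.
- by rewrite f0.
- by exists y => //; move: f1y; rewrite f1.
Qed.

(** Lift, from the point [u 0], a path of the hyperspace that ends at a tail of
    [u] avoiding [u 0]. *)
Lemma Sc_nonconstant_path (R : realType) (X : topologicalType) :
  hausdorff_space X -> ~ discrete_space X -> frechet_urysohn X ->
  pathwise_connected R (set_type (@Sc X)) ->
  exists2 f : R -> X, continuous f & f 0 <> f 1.
Proof.
move=> hX nd fuX pc; have [p [u [up u_p]]] := nondiscrete_sequence nd fuX.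
have [S [ScS SE]] := limit_range_Sc hX up u_p.
have : nbhs p (~` [set u 0%N]).
  apply: open_nbhs_nbhs; split; last exact/nesym.
  exact/closed_openC/accessible_closed_set1/hausdorff_accessible.
move=> /up[N _ Nu].
pose v n := u (n + N)%N.
have vp : v @ \oo --> p.
  move=> U /up[M _ MU]; exists M => // n Mn.
  by apply: MU; exact: leq_trans Mn (leq_addr _ _).
have [T [ScT TE]] := limit_range_Sc hX vp (fun n => u_p _).
have Su : CL_set S (u 0%N) by rewrite SE; right; exists 0%N.
have [y Ty [f [cf f0 f1]]] := Sc_path_lift hX pc ScS ScT Su.
exists f => //; rewrite f0 f1 => yu; move: Ty; rewrite TE -yu.
move=> [/u_p//|[n _ vn]].
by apply: (Nu (n + N)%N) => //=; exact: leq_addl.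
Qed.

Theorem corollary3p3 (R : realType) (X : topologicalType)
    (hausdorffX : hausdorff_space X)
    (infiniteX : infinite_set [set: X])
    (nondiscreteX : ~ discrete_space X)
    (frechetX : frechet_urysohn X)
    (pathSc : pathwise_connected R (set_type (@Sc X))) :
  pathwise_connected R X.
Proof.
have [f cf f01] := Sc_nonconstant_path hausdorffX nondiscreteX frechetX pathSc.
have [u [uf0 u_f0]] := path_range_limit hausdorffX frechetX cf f01.
have [T [ScT TE]] := limit_range_Sc hausdorffX uf0 u_f0.
have joined_f0 x : path_joined R x (f 0).
  have [S ScS Sx] := Sc_through x hausdorffX nondiscreteX frechetX.
  have [y Ty xy] := Sc_path_lift hausdorffX pathSc ScS ScT Sx.
  apply: path_joined_trans xy _.
  by move: Ty; rewrite TE => -[->|[n _ <-]]; exact: path_joined_range.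
move=> x y.
have [g [cg g0 g1]] :=
  path_joined_trans (joined_f0 x) (path_joined_sym (joined_f0 y)).
by exists g; split=> //; exact: continuous_subspaceT.
Qed.
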